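(* Let $k$ be a finite field of order $q$. For each integer $n\ge 1$, $W_n=V_n\oplus U_n$ (internal direct sum of $k$-linear subspaces of $k[x]_0$).
   Context: $k[x]_0$ denotes the free associative $k$-algebra without unit on one generator $x$ (polynomials in $x$ over $k$ with zero constant term). A $T$-space of $k[x]_0$ is a $k$-linear subspace invariant under all $k$-algebra endomorphisms of $k[x]_0$; a $T$-ideal is a $T$-space that is also an ideal. $W_n$ is the smallest $T$-space of $k[x]_0$ containing $x+x^{q^n}$ and $x^{q^n+1}$. $U_n$ is the smallest $T$-ideal of $k[x]_0$ containing $x-x^{q^{2n}}$. For $0\le i,j<q^n$ with $i\ne j$ let $F(i,j)=x^{iq^n+j}+x^{i+jq^n}$, and for $1\le i<q^n$ let $F(i,i)=(x^{q^n+1})^i$. Put $E_n=\{F(i,j)\mid q^n>i>j\ge 0\}\cup\{F(i,i)\mid 1\le i\le q^n-1\}$, and let $V_n$ be the $k$-linear span of $E_n$ in $k[x]_0$. *)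

(* Defs.v *)
From HB Require Import structures.
From mathcomp Require Import all_boot all_order all_algebra.
From mathcomp Require Import boolp classical_sets.

Set Implicit Arguments.
Unset Strict Implicit.
Unset Printing Implicit Defensive.

Import GRing.Theory.

Local Open Scope classical_set_scope.
Local Open Scope ring_scope.

(* MathComp has no non-unital algebras, so k[x]_0 is a subset of {poly k} and
   subspaces, ideals and endomorphisms of k[x]_0 are taken relative to it. *)
Definition poly0 (k : fieldType) : set {poly k} := [set p | p`_0 = 0].

Definition is_subspace (k : fieldType) (S : set {poly k}) : Prop :=
  S `<=` @poly0 k /\ GRing.submod_closed [in S].

(* Only the values of phi on k[x]_0 matter. *)
Record is_endo (k : fieldType) (phi : {poly k} -> {poly k}) : Prop := IsEndo {
  endo_stable : forall p, poly0 p -> poly0 (phi p);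
  endo_linear : forall (a : k) p r, poly0 p -> poly0 r ->
    phi (a *: p + r) = a *: phi p + phi r;
  endo_mul : forall p r, poly0 p -> poly0 r -> phi (p * r) = phi p * phi r
}.

Definition is_Tspace (k : fieldType) (S : set {poly k}) : Prop :=
  is_subspace S /\
  forall phi : {poly k} -> {poly k}, is_endo phi ->
    forall p, S p -> S (phi p).

Definition is_ideal (k : fieldType) (S : set {poly k}) : Prop :=
  is_subspace S /\ forall p r, poly0 p -> S r -> S (p * r).

Definition is_Tideal (k : fieldType) (S : set {poly k}) : Prop :=
  is_Tspace S /\ is_ideal S.

Definition W (k : finFieldType) (n : nat) : set {poly k} :=
  smallest (@is_Tspace k)
    [set 'X + 'X^(#|k| ^ n); 'X^(#|k| ^ n + 1)].

Definition U (k : finFieldType) (n : nat) : set {poly k} :=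
  smallest (@is_Tideal k) [set 'X - 'X^(#|k| ^ (2 * n))].

Definition F (k : finFieldType) (n i j : nat) : {poly k} :=
  if i == j then 'X^(#|k| ^ n + 1) ^+ i
  else 'X^(i * #|k| ^ n + j) + 'X^(i + j * #|k| ^ n).

Definition E (k : finFieldType) (n : nat) : set {poly k} :=
  [set p | exists i j : nat, (j < i < #|k| ^ n)%N /\ p = F k n i j] `|`
  [set p | exists i : nat, (1 <= i <= #|k| ^ n - 1)%N /\ p = F k n i i].

Definition V (k : finFieldType) (n : nat) : set {poly k} :=
  smallest (@is_subspace k) (@E k n).

Definition is_direct_sum (k : fieldType) (A B C : set {poly k}) : Prop :=
  [/\ is_subspace A, is_subspace B, is_subspace C,
      A = [set b + c | b in B & c in C] & B `&` C = [set 0]].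

(* Main.v *)
Require Import Defs.
From mathcomp Require Import all_boot all_order all_algebra.
From mathcomp Require Import fingroup pgroup abelian finfield.
From mathcomp Require Import boolp classical_sets.
From mathcomp Require Import ring zify.

Set Implicit Arguments.
Unset Strict Implicit.
Unset Printing Implicit Defensive.

Import GRing.Theory.

Local Open Scope classical_set_scope.
Local Open Scope ring_scope.

(* Write Q = q^n and D = X - X^(Q^2). Coefficients lie in the field with q
   elements, so f(X^Q) = f^Q, and U is the set of multiples of D in k[x]. Modulo
   D the substitution X -> X^Q is an involution which swaps the two base-Q digits
   of an exponent m < Q^2. Both V + U and W turn out to be the set of those p in
   k[x]_0 with p(X^Q) = p modulo D: this set is a T-space containing the two
   generators of W, and reducing such a p modulo D leaves a polynomial whose
   coefficients are symmetric in the two digits, which is a combination of E.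
   Conversely, W contains f^Q + f and, polarizing f^(Q+1), also f^Q g + f g^Q;
   for monomials f, g these yield E and the elements X^m D. *)

(** * Subspaces, endomorphisms and substitution in k[x]_0 *)

Section Subspaces.
Variable k : fieldType.
Implicit Types (S : set {poly k}) (p q : {poly k}).

Lemma is_subspaceP S : is_subspace S <->
  [/\ S `<=` @poly0 k, S 0 & forall a p q, S p -> S q -> S (a *: p + q)].
Proof.
split=> [[S0 [z l]]|[S0 z l]]; split=> //.
- by move: z; rewrite in_setE.
- by move=> a p q Sp Sq; have := l a p q; rewrite !in_setE; apply.
- by split=> [|a p q]; rewrite !in_setE //; apply: l.
Qed.

Lemma subspace0 S : is_subspace S -> S 0.
Proof. by case/is_subspaceP. Qed.

Lemma subspaceD S p q : is_subspace S -> S p -> S q -> S (p + q).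
Proof. by case/is_subspaceP=> _ _ l Sp Sq; rewrite -[p]scale1r; apply: l. Qed.

Lemma subspaceZ S a p : is_subspace S -> S p -> S (a *: p).
Proof. by case/is_subspaceP=> _ z l Sp; rewrite -[_ *: _]addr0; apply: l. Qed.

Lemma subspaceB S p q : is_subspace S -> S p -> S q -> S (p - q).
Proof.
by move=> sS Sp Sq; rewrite -scaleN1r; apply: subspaceD (subspaceZ _ sS Sq).
Qed.

Lemma subspace_sum S (I : Type) (r : seq I) (P : pred I) (G : I -> {poly k}) :
  is_subspace S -> (forall i, P i -> S (G i)) -> S (\sum_(i <- r | P i) G i).
Proof.
move=> sS SG; elim/big_ind: _ => //; first exact: subspace0.
by move=> p q; apply: subspaceD.
Qed.

Lemma poly0_subspace : is_subspace (@poly0 k).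
Proof.
apply/is_subspaceP; split=> [//||a p q]; rewrite /poly0 /= ?coef0 //.
by rewrite coefD coefZ => -> ->; rewrite mulr0 addr0.
Qed.

(** The intersection lies in k[x]_0 because [M] is one of the sets being intersected. *)
Lemma smallest_subspace (C : set {poly k} -> Prop) (G M : set {poly k}) :
  (forall S, C S -> is_subspace S) -> C M -> G `<=` M ->
  is_subspace (smallest C G).
Proof.
move=> Csub CM GM; apply/is_subspaceP; split.
- have /is_subspaceP[M0 _ _] := Csub _ CM.
  by apply: subset_trans M0; apply: smallest_sub.
- by move=> S [CS _]; apply: subspace0 (Csub _ CS).
- by move=> a p q Wp Wq S [CS GS]; apply: subspaceD (Csub _ CS) _ _;
    [apply: subspaceZ (Csub _ CS) _; apply: Wp | apply: Wq].
Qed.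

(** The image of ['X] determines [phi]. The induction runs over multiples [r * 'X], because [phi] is
    controlled on k[x]_0 only and no bare constant may appear. *)
Lemma endo_comp (phi : {poly k} -> {poly k}) p :
  is_endo phi -> poly0 p -> phi p = p \Po phi 'X.
Proof.
case=> phi0 phil phiM; rewrite /poly0 /= => p0.
have z0 : poly0 (0 : {poly k}) by rewrite /poly0 /= coef0.
have X0 : poly0 ('X : {poly k}) by rewrite /poly0 /= coefX.
have mX0 r : poly0 (r * 'X : {poly k}) by rewrite /poly0 /= coefMX.
have phiX r : phi (r * 'X) = (r * 'X) \Po phi 'X.
  elim/poly_ind: r => [|r c IHr].
    (* Linearity at [a = -1] with zero arguments gives [phi 0 = 0]. *)
    have := phil (-1) 0 0 z0 z0.
    by rewrite mul0r comp_poly0 scaler0 add0r scaleN1r addNr.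
  rewrite mulrDl mul_polyC addrC phil // phiM // IHr.
  by rewrite comp_polyD comp_polyZ !comp_polyM !comp_polyX.
have -> : p = drop_poly 1 p * 'X.
  apply/polyP=> -[|i]; first by rewrite coefMX p0.
  by rewrite coefMX coef_drop_poly addn1.
exact: phiX.
Qed.

Lemma comp_endo (f : {poly k}) :
  poly0 f -> is_endo (fun p : {poly k} => p \Po f).
Proof.
move=> f0; split=> [p p0|a p r _ _|p r _ _].
- rewrite /poly0 /= -horner_coef0 horner_comp horner_coef0 [f`_0]f0.
  by rewrite horner_coef0.
- by rewrite comp_polyD comp_polyZ.
- by rewrite comp_polyM.
Qed.

Lemma Tspace_comp S p f :
  is_Tspace S -> S p -> poly0 f -> S (p \Po f).
Proof. by move=> [_ endoS] Sp /comp_endo/endoS; apply. Qed.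

(** This is the factor theorem with root [q] in k[x]. *)
Lemma dvdp_sub_comp p q : 'X - q %| p - (p \Po q).
Proof.
elim/poly_ind: p => [|p c IHp]; first by rewrite comp_poly0 subrr.
rewrite comp_poly_MXaddC.
have -> : p * 'X + c%:P - ((p \Po q) * q + c%:P)
        = (p - (p \Po q)) * 'X + (p \Po q) * ('X - q) by ring.
by apply: dvdp_add; [apply: dvdp_mulr | apply: dvdp_mulIr].
Qed.

Lemma size_XsubXn m : (1 < m)%N -> size ('X - 'X^m : {poly k}) = m.+1.
Proof.
move=> m1; rewrite addrC size_polyDl size_polyN size_polyXn //.
by rewrite size_polyX.
Qed.

Lemma digit_expansion Q (r : {poly k}) : (size r <= Q * Q)%N ->
  r = \sum_(i < Q) \sum_(j < Q) r`_(i * Q + j) *: 'X^(i * Q + j).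
Proof.
move=> szr; rewrite -[LHS](take_poly_id szr) /take_poly poly_def.
rewrite -(big_mkord xpredT (fun i => r`_i *: 'X^i)) big_nat_mul big_mkord.
apply: eq_bigr => i _; rewrite -{1}[(i * Q)%N]add0n big_addn.
rewrite mulSn addnK big_mkord; apply: eq_bigr => j _.
by rewrite addnC.
Qed.

End Subspaces.

(** * The Q-th power map as a substitution *)

Section Frobenius.
Variables (k : finFieldType) (n : nat).
Local Notation Q := (#|k| ^ n)%N.

(** The additive group of k is an elementary abelian p-group, so Q is a power of the characteristic,
    and the Q-th power map is additive. *)
Lemma pchar_card_pow : [pchar {poly k}].-nat Q.
Proof.
have [p p_pr charp] := finPcharP k.
have := abelem_pgroup (fin_ring_pchar_abelem charp).
rewrite /pgroup cardsT => pk.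
rewrite pnatX; apply/orP; left; apply: sub_in_pnat pk => q _ /eqnP->.
by rewrite pchar_poly.
Qed.

Lemma expf_card_pow (c : k) : c ^+ Q = c.
Proof.
by elim: n => [|m IHm]; rewrite ?expr1 // expnS exprM expf_card IHm.
Qed.

Lemma comp_Xcard (f : {poly k}) : f \Po 'X^Q = f ^+ Q.
Proof.
elim/poly_ind: f => [|f c IHf].
  by rewrite comp_poly0 expr0n expn_eq0 -leqn0 leqNgt (ltnW (finNzRing_gt1 k)).
rewrite comp_poly_MXaddC IHf exprDn_pchar ?pchar_card_pow // exprMn.
by rewrite -polyC_exp expf_card_pow.
Qed.

End Frobenius.

(** * The T-ideal U as the set of multiples of D *)

Section Decomposition.
Variables (k : finFieldType) (n : nat).
Hypothesis n_gt0 : (0 < n)%N.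
Local Notation Q := (#|k| ^ n)%N.
Local Notation D := ('X - 'X^(Q * Q) : {poly k}).

Let Q_gt1 : (1 < Q)%N.
Proof.
apply: leq_trans (finNzRing_gt1 k) _.
by rewrite -{1}[#|k|]expn1 leq_exp2l ?finNzRing_gt1.
Qed.

Let QQ_gt1 : (1 < Q * Q)%N.
Proof. nia. Qed.

Let XQQ : 'X^Q ^+ Q = 'X^(Q * Q) :> {poly k}.
Proof. by rewrite exprM. Qed.

Lemma poly0_Xn m : (0 < m)%N -> poly0 ('X^m : {poly k}).
Proof. by rewrite /poly0 /= coefXn; case: m. Qed.

(** D(f) = f - f^(Q^2) = f - f(X^(Q^2)), so the factor theorem applies with root X^(Q^2). *)
Lemma dvd_D_comp (f : {poly k}) : poly0 f -> D %| D \Po f.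
Proof.
move=> _; rewrite comp_polyB comp_polyX comp_Xn_poly [f ^+ _]exprM.
rewrite -[f ^+ _ ^+ _]comp_Xcard -[f ^+ _]comp_Xcard -comp_polyA.
by rewrite comp_Xn_poly -exprM; apply: dvdp_sub_comp.
Qed.

Lemma dvd_D_poly0 (p : {poly k}) : D %| p -> poly0 p.
Proof.
case/dvdpP=> r ->; rewrite /poly0 /= coef0M coefB coefX coefXn.
by rewrite [_ == (Q * Q)%N]ltn_eqF ?subrr ?mulr0 // ltnW.
Qed.

Lemma size_D : size D = (Q * Q).+1.
Proof. exact: size_XsubXn. Qed.

Lemma dvd_D_small (p : {poly k}) : D %| p -> (size p <= Q * Q)%N -> p = 0.
Proof.
move=> Dp szp; apply/eqP; apply: contraTT szp => /dvdp_leq/(_ Dp).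
by rewrite size_D -ltnNge.
Qed.

Lemma dvd_D_Tideal : is_Tideal [set p : {poly k} | D %| p].
Proof.
have sub : is_subspace [set p : {poly k} | D %| p].
  apply/is_subspaceP; split=> [p /dvd_D_poly0 //||a p q /= Dp Dq].
    by rewrite /= dvdp0.
  by rewrite dvdp_add // -mul_polyC dvdp_mull.
split; split=> //; last by move=> p r _ /= Dr; rewrite dvdp_mull.
move=> phi ephi p /= Dp.
rewrite (endo_comp ephi); last exact: dvd_D_poly0.
apply: dvdp_trans (dvd_D_comp _) (dvdp_comp_poly _ Dp).
by apply: (endo_stable ephi); rewrite /poly0 /= coefX.
Qed.

Lemma U_dvd : @U k n = [set p : {poly k} | D %| p].
Proof.
rewrite /U mul2n -addnn expnD; apply/seteqP; split.
  by apply: smallest_sub; [exact: dvd_D_Tideal | move=> p /= ->].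
move=> p /= /dvdpP[r ->{p}] M [[_ [sM idM]]]; rewrite sub1set in_setE => MD.
(* An ideal absorbs factors from k[x]_0, so the multiplier is split as [r * 'X + c]: the first part
   is absorbed and the constant acts as a scalar. *)
elim/poly_ind: r => [|r c _]; first by rewrite mul0r; apply: subspace0.
rewrite mulrDl mul_polyC; apply: (subspaceD sM).
  by apply: idM => //; rewrite /poly0 /= coefMX.
exact: subspaceZ.
Qed.

(** * Polynomials fixed by X -> X^Q modulo D *)

Definition frob_sym : set {poly k} :=
  [set p : {poly k} | p`_0 = 0 /\ D %| p - (p \Po 'X^Q)].

(** Substituting f commutes with X -> X^Q, since f(X^Q) = f^Q. So p(f) minus its Frobenius twist is
    p - p(X^Q) evaluated at f, a multiple of D(f) and hence of D. *)
Lemma frob_sym_Tspace : is_Tspace frob_sym.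
Proof.
split.
  apply/is_subspaceP; split=> [p []//||a p q [p0 Dp] [q0 Dq]].
    by split; rewrite ?coef0 // comp_poly0 subrr dvdp0.
  split; first by rewrite coefD coefZ p0 q0 mulr0 addr0.
  rewrite comp_polyD comp_polyZ opprD addrACA -scalerBr.
  by rewrite dvdp_add // -mul_polyC dvdp_mull.
move=> phi ephi p [p0 Dp]; have f0 : poly0 (phi 'X).
  by apply: (endo_stable ephi); rewrite /poly0 /= coefX.
split; first exact: (endo_stable ephi).
rewrite (endo_comp ephi) // -comp_polyA comp_Xcard.
rewrite -[phi 'X ^+ _]comp_Xn_poly comp_polyA.
by rewrite -comp_polyB; apply: dvdp_trans (dvd_D_comp f0) (dvdp_comp_poly _ Dp).
Qed.

Lemma W_gen_frob_sym :
  [set 'X + 'X^Q; 'X^(Q + 1)] `<=` frob_sym.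
Proof.
move=> p [->|->]; split.
- by rewrite coefD coefX coefXn [_ == Q]ltn_eqF ?addr0 // ltnW.
- rewrite comp_polyD comp_polyX comp_Xn_poly XQQ.
  have -> : 'X + 'X^Q - ('X^Q + 'X^(Q * Q)) = D by ring.
  exact: dvdpp.
- by rewrite coefXn addn1.
  rewrite comp_Xn_poly !exprD XQQ !expr1.
  have -> : 'X^Q * 'X - 'X^(Q * Q) * 'X^Q = 'X^Q * D by ring.
  by rewrite dvdp_mulIr.
Qed.

Lemma W_sub_frob_sym : @W k n `<=` frob_sym.
Proof. exact: smallest_sub frob_sym_Tspace W_gen_frob_sym. Qed.

Lemma W_subspace : is_subspace (@W k n).
Proof.
by apply: smallest_subspace frob_sym_Tspace W_gen_frob_sym => S [].
Qed.

(** * V and U inside W *)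

Lemma W_addX (f : {poly k}) : poly0 f -> W n (f + f ^+ Q).
Proof.
move=> f0 S [TS genS]; rewrite -[f ^+ _]comp_Xn_poly -[X in X + _](comp_polyX f).
by rewrite -comp_polyD; apply: Tspace_comp => //; apply: genS; left.
Qed.

Lemma W_norm (f : {poly k}) : poly0 f -> W n (f ^+ (Q + 1)).
Proof.
move=> f0 S [TS genS]; rewrite -[f ^+ _]comp_Xn_poly.
by apply: Tspace_comp => //; apply: genS; right.
Qed.

Lemma W_trace (f g : {poly k}) : poly0 f -> poly0 g ->
  W n (f ^+ Q * g + f * g ^+ Q).
Proof.
move=> f0 g0; have fg0 := subspaceD (poly0_subspace k) f0 g0.
have -> : f ^+ Q * g + f * g ^+ Q =
    (f + g) ^+ (Q + 1) - f ^+ (Q + 1) - g ^+ (Q + 1).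
  by rewrite !addn1 !exprSr exprDn_pchar ?pchar_card_pow //; ring.
apply: (subspaceB W_subspace); last exact: W_norm.
by apply: (subspaceB W_subspace); apply: W_norm.
Qed.

Lemma V_sub_W : @V k n `<=` @W k n.
Proof.
apply: smallest_sub; first exact: W_subspace.
move=> p [[i [j [/andP[ji _] ->]]]|[i [/andP[i1 _] ->]]]; rewrite /F.
  have i0 : (0 < i)%N by apply: leq_ltn_trans ji.
  (* The digit j = 0 is treated apart: ['X^0] is not in k[x]_0, so [W_addX] replaces [W_trace]. *)
  rewrite gtn_eqF //; have [->|j0] := posnP j.
    by rewrite addn0 mul0n addn0 addrC exprM; apply: W_addX; apply: poly0_Xn.
  by rewrite !exprD !exprM; apply: W_trace; apply: poly0_Xn.
by rewrite eqxx -exprM mulnC exprM; apply: W_norm; apply: poly0_Xn.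
Qed.

(** For m > 0 and f = X^(m+1), subtracting the trace term of X^Q and X^m from f + f^Q leaves X^m D.
    For m = 0, X^m is not in k[x]_0, and D is the difference of the values of f + f^Q at f = X and f
    = X^Q. *)
Lemma W_XnD m : W n ('X^m * D).
Proof.
case: m => [|m].
  have -> : 'X^0 * D = 'X + 'X ^+ Q - ('X^Q + 'X^Q ^+ Q).
    by rewrite XQQ expr0; ring.
  apply: (subspaceB W_subspace); apply: W_addX.
    by rewrite /poly0 /= coefX.
  by apply: poly0_Xn; apply: ltnW.
have -> : 'X^(m.+1) * D = 'X^(m.+2) + 'X^(m.+2) ^+ Q
    - ('X^Q ^+ Q * 'X^(m.+1) + 'X^Q * 'X^(m.+1) ^+ Q).
  by rewrite XQQ ['X^(m.+2)]exprS exprMn; ring.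
apply: (subspaceB W_subspace); [apply: W_addX|apply: W_trace];
  by apply: poly0_Xn => //; apply: ltnW.
Qed.

Lemma U_sub_W : @U k n `<=` @W k n.
Proof.
rewrite U_dvd => p /= /dvdpP[r ->]; rewrite -[r]coefK poly_def mulr_suml.
apply: (subspace_sum _ W_subspace) => i _; rewrite -scalerAl.
by apply: (subspaceZ _ W_subspace); apply: W_XnD.
Qed.

(** * V as the polynomials with digit-symmetric coefficients *)

Lemma size_V (p : {poly k}) : V n p -> poly0 p /\ (size p <= Q * Q)%N.
Proof.
pose S := [set p : {poly k} | poly0 p /\ (size p <= Q * Q)%N].
have sS : is_subspace S.
  apply/is_subspaceP; split=> [q []//||a q r [q0 sq] [r0 sr]].
    by split; rewrite ?size_poly0 //; apply: subspace0 (poly0_subspace k).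
  have s0 := poly0_subspace k.
  split; first exact: subspaceD s0 (subspaceZ _ s0 q0) r0.
  apply: leq_trans (size_polyD _ _) _; rewrite geq_max sr andbT.
  exact: leq_trans (size_scale_leq _ _) sq.
have SX m : (0 < m < Q * Q)%N -> S 'X^m.
  by case/andP=> m0 mQ; split; [apply: poly0_Xn | rewrite size_polyXn].
apply: (smallest_sub sS) => {}p.
move=> [[i [j [/andP[ji iQ] ->]]]|[i [/andP[i1 iQ] ->]]]; rewrite /F.
  by rewrite gtn_eqF //; apply: (subspaceD sS); apply: SX; nia.
by rewrite eqxx -exprM; apply: SX; nia.
Qed.

Lemma V_subspace : is_subspace (@V k n).
Proof.
apply: (smallest_subspace (M := @poly0 k)) => //; first exact: poly0_subspace.
by move=> p Ep; case: (size_V (sub_gen_smallest Ep)).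
Qed.

(** Induction on the side of the square of digit pairs: passing from m to m+1 adds a row and a
    column, which pair up into the F(m, j), and the corner F(m, m). *)
Lemma V_sym_sum (c : nat -> nat -> k) m : (m <= Q)%N -> c 0 0 = 0 ->
  (forall i j, (i < Q)%N -> (j < Q)%N -> c i j = c j i) ->
  V n (\sum_(i < m) \sum_(j < m) c i j *: 'X^(i * Q + j)).
Proof.
move=> + c0 cC; elim: m => [_|m IHm mQ].
  by rewrite big_ord0; apply: subspace0 V_subspace.
rewrite big_ord_recr /=; under eq_bigr do rewrite big_ord_recr /=.
rewrite big_split /= big_ord_recr /= -addrA [X in _ + X]addrA -big_split /=.
apply: (subspaceD V_subspace); first by apply: IHm; apply: ltnW.
apply: (subspaceD V_subspace).
  apply: (subspace_sum _ V_subspace) => j _.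
  rewrite cC ?(ltn_trans (ltn_ord j)) // -scalerDr.
  apply: (subspaceZ _ V_subspace); apply: sub_gen_smallest; left.
  exists m, j; rewrite ltn_ord mQ; split=> //.
  by rewrite /F gtn_eqF // addrC [(m + _)%N]addnC.
(* At m = 0 the corner is the constant term, which [c0] kills; F(0, 0) is not in [E]. *)
case: m mQ {IHm} => [|m] mQ; first by rewrite c0 scale0r;
  apply: subspace0 V_subspace.
apply: (subspaceZ _ V_subspace); apply: sub_gen_smallest; right.
exists m.+1; split; first by lia.
by rewrite /F eqxx -exprM mulnDl mul1n mulnC.
Qed.

Lemma V_of_frob_sym (r : {poly k}) : (size r <= Q * Q)%N -> frob_sym r -> V n r.
Proof.
move=> szr [r0 Dr]; rewrite (digit_expansion szr).
(* [r'] is [r] with the two base-Q digits of each exponent swapped. *)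
pose r' := \poly_(m < Q * Q) r`_(m %% Q * Q + m %/ Q).
have r'E i j : (i < Q)%N -> (j < Q)%N -> r'`_(i * Q + j) = r`_(j * Q + i).
  move=> iQ jQ; rewrite coef_poly modnMDl divnMDl ?(ltnW Q_gt1) //.
  by rewrite modn_small // divn_small // addn0 ifT //; nia.
have dvd_sum (G : 'I_Q -> {poly k}) :
    (forall i, D %| G i) -> D %| \sum_i G i.
  move=> DG; apply: (big_ind (fun p : {poly k} => D %| p)) => //.
  by move=> p q; apply: dvdp_add.
(* Term by term: (X^Q)^(iQ+j) = X^(iQ^2+jQ) is congruent to X^(jQ+i), because X^(Q^2) is congruent
   to X modulo D. *)
have Dr' : D %| (r \Po 'X^Q) - r'.
  rewrite [r'](@digit_expansion _ Q) ?size_poly // {1}(digit_expansion szr).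
  rewrite [X in _ %| _ - X]exchange_big [_ \Po _]raddf_sum /= -sumrB.
  apply: (dvd_sum) => i; rewrite [_ \Po _]raddf_sum /= -sumrB.
  apply: (dvd_sum) => j.
  rewrite r'E // comp_polyZ comp_Xn_poly -scalerBr -mul_polyC.
  apply: dvdp_mull.
  have -> : 'X^Q ^+ (i * Q + j) - 'X^(j * Q + i) =
      - ('X^(j * Q)) * ('X^i - ('X^i \Po 'X^(Q * Q))) :> {poly k}.
    rewrite comp_Xn_poly -!exprM mulnDr !exprD [(j * Q)%N]mulnC.
    by rewrite [(Q * (i * Q))%N]mulnCA [(i * _)%N]mulnC; ring.
  by rewrite dvdp_mull // dvdp_sub_comp.
(* Both are congruent to r(X^Q) modulo D and have degree below Q^2, the degree of D. *)
have rE : r = r'.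
  apply: subr0_eq; apply: dvd_D_small.
    by have := dvdp_add Dr Dr'; rewrite addrA subrK.
  by rewrite (leq_trans (size_polyD _ _)) // geq_max size_polyN szr size_poly.
apply: (V_sym_sum (c := fun i j => r`_(i * Q + j))) => // i j iQ jQ.
by rewrite {1}rE r'E.
Qed.

End Decomposition.

Theorem proposition2p1 (k : finFieldType) (n : nat) (hn : (1 <= n)%N) :
  is_direct_sum (@W k n) (@V k n) (@U k n).
Proof.
have sW := W_subspace k hn; have sV := V_subspace k hn.
split=> //.
- by rewrite U_dvd //; case: (dvd_D_Tideal k hn) => _ [].
- apply/seteqP; split=> [p Wp|_ [p Vp [r Ur <-]]]; last first.
    by apply: (subspaceD sW); [apply: V_sub_W | apply: U_sub_W].
  have [p0 Dp] := W_sub_frob_sym hn Wp.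
  set D : {poly k} := 'X - 'X^(#|k| ^ n * #|k| ^ n) in Dp.
  (* Euclidean division by D splits p: the multiple of D is in U, and the remainder is still fixed
     by X -> X^Q modulo D, so it is in V. *)
  have UD : U n (p %/ D * D) by rewrite U_dvd //= dvdp_mull.
  have rE : p %% D = p - p %/ D * D by rewrite {2}(divp_eq p D) addrC addKr.
  exists (p %% D); last by exists (p %/ D * D); rewrite // addrC -divp_eq.
  apply: V_of_frob_sym => //.
    by rewrite -ltnS -size_D // ltn_modp -size_poly_eq0 size_D.
  rewrite rE; case: (frob_sym_Tspace k n) => sS _.
  apply: (subspaceB sS); first exact: W_sub_frob_sym.
  by apply: W_sub_frob_sym => //; apply: U_sub_W.
(* A common element is a multiple of D of degree below that of D, hence zero. *)
- apply/seteqP; split=> [p [Vp Up]|_ ->]; last first.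
    by split; [apply: subspace0 | rewrite U_dvd //= dvdp0].
  have [_ szp] := size_V hn Vp; move: Up; rewrite U_dvd //= => Dp.
  exact: dvd_D_small szp.
Qed.
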